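(* Let $(G,\ell)$ be a group with length function, let $\mathfrak h$ be an infinite dimensional Hilbert space, and let $d^{U(\mathfrak h)}$ be a bi-invariant metric on $U(\mathfrak h)$. Let $\ell^{dd}$ be the resulting double-dual of $\ell$. Then: (1) $\ell^{dd}(g)\le\ell(g)$ for all $g\in G$. (2) If $G$ admits an isometric representation, i.e. a representation $\rho\in\mathrm{Reps}(G)$ with $\ell^{U(\mathfrak h)}(\rho_g)=\ell(g)$ for all $g\in G$, then $\ell^{dd}=\ell$. (3) More generally, $\ell^{dd}=\ell$ if for each $g\in G$ there exists a representation $\rho\in\mathrm{Reps}(G)$ with $\ell^{\mathrm{Reps}}(\rho)\ne0$ such that $$\ell(g)=\frac{\ell^{U(\mathfrak h)}(\rho_g)}{\ell^{\mathrm{Reps}}(\rho)}.$$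
   Context: A length function on a group $G$ is a function $\ell:G\to[0,\infty]$ vanishing exactly at the identity, with $\ell(g)=\ell(g^{-1})$ and $\ell(gg')\le\ell(g)+\ell(g')$. $U(\mathfrak h)$ is the group of unitary operators on $\mathfrak h$; metrics may take the value $\infty$; bi-invariant means invariant under left and right multiplication. Put $\ell^{U(\mathfrak h)}(u):=d^{U(\mathfrak h)}(\mathrm{id},u)$. $\mathrm{Reps}(G)$ denotes the unitary representations $\rho:G\to U(V_\rho)$ of $G$ on Hilbert spaces $V_\rho$ admitting an isometry into $\mathfrak h$ (assumed to form a set). For each $\rho$ fix a linear isometry $a:V_\rho\hookrightarrow\mathfrak h$ and let $a_*\rho:G\to U(\mathfrak h)$ be the representation equal to $a\rho a^{-1}$ on $a(V_\rho)$ and to the identity on $a(V_\rho)^\perp$. The choice of $a$ is suppressed and $\ell^{U(\mathfrak h)}(\rho_g)$ means $\ell^{U(\mathfrak h)}((a_*\rho)_g)$. Define $$\ell^{\mathrm{Reps}}(\rho):=\sup_{\ell(g)\ne0}\frac{\ell^{U(\mathfrak h)}(\rho_g)}{\ell(g)}\in[0,\infty],\qquad \ell^{dd}(g):=\sup_{\ell^{\mathrm{Reps}}(\rho)\ne0}\frac{\ell^{U(\mathfrak h)}(\rho_g)}{\ell^{\mathrm{Reps}}(\rho)}\in[0,\infty],$$ the second supremum being over $\rho\in\mathrm{Reps}(G)$. The function $\ell^{dd}$ is the double-dual of $\ell$. Conventions: $\sup\emptyset=0$; in the quotients defining $\ell^{\mathrm{Reps}}$, $c/\infty=0$ for $c<\infty$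 and $\infty/\infty=1$; quotients with denominator $\ell^{\mathrm{Reps}}(\rho)=\infty$ are $0$. *)

(* Defs.v *)
From HB Require Import structures.
From mathcomp Require Import all_boot all_order all_algebra.
From mathcomp Require Import all_classical all_reals all_analysis.
From mathcomp Require Import complex.
From mathcomp Require Import ring lra.

Set Implicit Arguments.
Unset Strict Implicit.
Unset Printing Implicit Defensive.

Import Order.TTheory GRing.Theory Num.Theory.
Import numFieldNormedType.Exports.
Import ComplexField.

Local Open Scope classical_set_scope.
Local Open Scope ring_scope.

(* The inner product is linear in its first argument and conjugate-linear in
   its second one. *)
HB.mixin Record isHilbert (R : realType) V of CompleteNormedModule R[i] V := {
  inner : {dot V for (@Num.conj R[i])};
  innerE : forall x : V, inner x x = `|x| ^+ 2
}.

#[short(type="hilbertType")]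
HB.structure Definition Hilbert (R : realType) :=
  {V of isHilbert R V & CompleteNormedModule R[i] V}.

Definition infinite_dimensional (R : realType) (V : hilbertType R) :=
  forall (n : nat) (e : 'I_n -> V),
    exists v : V, forall c : 'I_n -> R[i], v <> \sum_(i < n) c i *: e i.

Record linear_isometry (R : realType) (V W : hilbertType R) := LinearIsometry {
  isometry_fun :> {linear V -> W};
  isometry_norm : forall v, `|isometry_fun v| = `|v|
}.

Record unitary (R : realType) (V : hilbertType R) := Unitary {
  unitary_fun :> V -> V;
  unitary_linear : linear unitary_fun;
  unitary_bij : bijective unitary_fun;
  unitary_inner : forall x y, inner (unitary_fun x) (unitary_fun y) = inner x y
}.

Section UnitaryGroup.
Context {R : realType} {V : hilbertType R}.
Implicit Types u v w : unitary V.

Lemma unitary_ext u v : u =1 v -> u = v.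
Proof.
case: u v => [f fl fb fi] [g gl gb gi] /= /funext fg.
by subst g; congr Unitary; exact: Prop_irrelevance.
Qed.

HB.instance Definition _ := gen_eqMixin (unitary V).
HB.instance Definition _ := gen_choiceMixin (unitary V).

Fact one_linear : linear (@id V). Proof. by []. Qed.
Fact one_bij : bijective (@id V). Proof. by exists id. Qed.
Definition unitary_one := Unitary one_linear one_bij (fun _ _ => erefl).

Fact mul_linear u v : linear (u \o v).
Proof. by move=> c x y /=; rewrite !unitary_linear. Qed.
Fact mul_inner u v x y : inner ((u \o v) x) ((u \o v) y) = inner x y.
Proof. by rewrite /= !unitary_inner. Qed.
Definition unitary_mul u v :=
  Unitary (mul_linear u v) (bij_comp (unitary_bij u) (unitary_bij v))
    (mul_inner u v).

Fact inv_exists u : exists v, cancel u v /\ cancel v u.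
Proof.
have [g uK gK] := unitary_bij u.
have gl : linear g by move=> c x y; apply: (can_inj uK); rewrite unitary_linear !gK.
have gb : bijective g by exists u.
have gi x y : inner (g x) (g y) = inner x y by rewrite -(unitary_inner u) !gK.
by exists (Unitary gl gb gi).
Qed.
Definition unitary_inv u := projT1 (cid (inv_exists u)).
Lemma unitary_funK u : cancel u (unitary_inv u).
Proof. by rewrite /unitary_inv; case: cid => ? []. Qed.
Lemma unitary_invK u : cancel (unitary_inv u) u.
Proof. by rewrite /unitary_inv; case: cid => ? []. Qed.

Fact unitary_mulA : associative unitary_mul.
Proof. by move=> u v w; exact: unitary_ext. Qed.
Fact unitary_mul1 : left_id unitary_one unitary_mul.
Proof. by move=> u; exact: unitary_ext. Qed.
Fact unitary_mulr1 : right_id unitary_one unitary_mul.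
Proof. by move=> u; exact: unitary_ext. Qed.
Fact unitary_mulV : left_inverse unitary_one unitary_inv unitary_mul.
Proof. by move=> u; apply: unitary_ext => x /=; exact: unitary_funK. Qed.
Fact unitary_mulrV : right_inverse unitary_one unitary_inv unitary_mul.
Proof. by move=> u; apply: unitary_ext => x /=; exact: unitary_invK. Qed.

HB.instance Definition _ := isGroup.Build (unitary V) unitary_mulA unitary_mul1
  unitary_mulr1 unitary_mulV unitary_mulrV.

End UnitaryGroup.

Section Projection.
Context {R : realType} {V W : hilbertType R}.
Variable a : linear_isometry V W.

Let q (U : hilbertType R) (x : U) : R := complex.Re (inner x x).

Let qE (U : hilbertType R) (x : U) : inner x x = (q x)%:C%C.
Proof.
have : 0 <= inner x x by rewrite innerE exprn_ge0.
by rewrite /q; case: (inner x x) => r s; rewrite lecE /= => /andP[/eqP -> _].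
Qed.

(* The norm of a normed module over [R[i]] takes its values in [R[i]]. *)
Let nrm (U : hilbertType R) (x : U) : R := complex.Re `|x|.

Let nrmE (U : hilbertType R) (x : U) : `|x| = (nrm x)%:C%C.
Proof.
have : 0 <= `|x| by [].
by rewrite /nrm; case: `|x| => r s; rewrite lecE /= => /andP[/eqP -> _].
Qed.

Let nrm_ge0 (U : hilbertType R) (x : U) : 0 <= nrm x.
Proof. by rewrite -ler0c -nrmE. Qed.

Let q_nrm (U : hilbertType R) (x : U) : q x = nrm x ^+ 2.
Proof. by apply: complexI; rewrite -qE innerE nrmE rmorphXn. Qed.

Let nrmD (U : hilbertType R) (x y : U) : nrm (x + y) <= nrm x + nrm y.
Proof. by rewrite -lecR rmorphD /= -!nrmE ler_normD. Qed.

Let nrm_iso x : nrm (a x) = nrm x.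
Proof. by rewrite /nrm isometry_norm. Qed.

Let parallelogram (U : hilbertType R) (x y : U) :
  q (x + y) + q (x - y) = 2 * q x + 2 * q y.
Proof.
apply: complexI; rewrite rmorphD /= -!qE dnormD dnormB.
by rewrite !rmorphD /= !rmorphM /= -!qE; ring.
Qed.

Let qZ (U : hilbertType R) (t : R) (x : U) : q (t%:C%C *: x) = t ^+ 2 * q x.
Proof.
apply: complexI.
rewrite -qE dnormZ qE rmorphM /= rmorphXn /=; congr (_ * _).
by rewrite -normrX ger0_norm // -rmorphXn /= ler0c sqr_ge0.
Qed.

Let minimizer (w : W) : exists v, forall y, nrm (w - a v) <= nrm (w - a y).
Proof.
pose f v := q (w - a v).
have f0 v : 0 <= f v by rewrite /f q_nrm sqr_ge0.
have hi : has_inf (range f).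
  by split; [exists (f 0), 0 | exists 0 => _ [v _ <-]].
pose m := inf (range f).
have mf v : m <= f v by apply: ge_inf; [exact: hi.2 | exists v].
have near_m e : 0 < e -> exists v, f v < m + e.
  by move=> e0; have [_ [v _ <-] ve] := inf_adherent e0 hi; exists v.
have close e x y : f x < m + e -> f y < m + e -> q (x - y) < 4 * e.
  move=> fx fy.
  have := parallelogram (w - a x) (w - a y).
  have -> : (w - a x) - (w - a y) = - a (x - y).
    by rewrite (linearB a) !opprB addrC addrA subrK.
  have -> : (w - a x) + (w - a y) = 2%:C%C *: (w - a (2^-1%:C%C *: (x + y))).
    rewrite scalerBr (linearZ_LR a) /= scalerA -rmorphM /= divff ?pnatr_eq0 //.
    rewrite scale1r (linearD a) /= rmorph_nat scaler_nat mulr2n opprD.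
    by rewrite addrACA.
  rewrite qZ.
  have -> : q (- a (x - y)) = q (x - y).
    by rewrite !q_nrm /nrm normrN isometry_norm.
  rewrite -/(f _) -/(f x) -/(f y).
  have := mf (2^-1%:C%C *: (x + y)); nra.
pose B e := [set v | f v < m + e].
pose F := filter_from [set e : R | 0 < e] B.
have FF : ProperFilter F.
  apply: filter_from_proper => [|e /near_m[v fv]]; last by exists v.
  apply: filter_from_filter; first by exists 1 => /=.
  move=> e1 e2 /= e10 e20; exists (Num.min e1 e2) => /=.
    by rewrite lt_min e10.
  move=> v; rewrite /B /= => fv; split; apply: lt_le_trans fv _;
    by rewrite lerD2l ge_min lexx ?orbT.
have /cvg_ex[v Fv] : cvg F.
  apply: cauchy_cvg; apply/cauchy_ballP => e e0.
  have [r r0 re] : exists2 r : R, 0 < r & e = r%:C%C.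
    move: e0; case: e => r s; rewrite ltcE /= => /andP[/eqP -> r0].
    by exists r.
  exists (B (r ^+ 2 / 4), B (r ^+ 2 / 4)).
    by split; exists (r ^+ 2 / 4) => //=; rewrite divr_gt0 ?exprn_gt0.
  move=> [x y] [/= fx fy]; rewrite -ball_normE /= re nrmE ltcR.
  have := close _ _ _ fx fy; rewrite q_nrm.
  have := nrm_ge0 (x - y); nra.
exists v => y; rewrite leNgt; apply/negP => lt.
set d := nrm (w - a v) in lt *; set r := nrm (w - a y) in lt *.
pose e := d - r; have e0 : 0 < e by rewrite subr_gt0.
have r0 : 0 <= r by exact: nrm_ge0.
have FB : F (B (e ^+ 2 / 4)).
  by exists (e ^+ 2 / 4) => //=; rewrite divr_gt0 ?exprn_gt0.
have Fb : F (ball v (e / 2)%:C%C).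
  by apply: Fv; apply: nbhsx_ballx; rewrite ltcR divr_gt0.
have [u [fu bu]] := filter_ex (filterI FB Fb).
have vu : nrm (v - u) < e / 2.
  by move: bu; rewrite -ball_normE /= nrmE ltcR.
have du : d <= nrm (w - a u) + nrm (v - u).
  rewrite -(nrm_iso (v - u)) /d.
  have -> : nrm (a (v - u)) = nrm (a (u - v)).
    by rewrite -opprB linearN /= /nrm normrN.
  apply: le_trans _ (nrmD _ _); rewrite linearB /= addrA subrK //.
have wu : nrm (w - a u) < r + e / 2.
  have : f u < m + e ^+ 2 / 4 by [].
  have := mf y; rewrite /f !q_nrm -/r.
  have := nrm_ge0 (w - a u).
  by nra.
by move: du vu wu; rewrite /e; lra.
Qed.

Lemma isometry_inner x y : inner (a x) (a y) = inner x y.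
Proof.
have re (u v : V) : complex.Re (inner (a u) (a v)) = complex.Re (inner u v).
  have : inner (a (u + v)) (a (u + v)) = inner (u + v) (u + v).
    by rewrite !innerE isometry_norm.
  rewrite linearD /= !dnormD !innerE !isometry_norm => /addrI.
  have ReD (z : R[i]) : z + (z^*)%R = (2 * complex.Re z)%:C%C.
    by case: z => s t; apply/eqP; rewrite eq_complex /= mulr_natl subrr mulr2n !eqxx.
  rewrite !ReD => /complexI; lra.
apply/eqP; rewrite eq_complex re eqxx /=.
have := re ('i%C *: x) y.
rewrite linearZ /= !linearZl_LR /= mulrC ReiNIm mulrC ReiNIm.
by move/oppr_inj => ->.
Qed.

Fact coord_exists (w : W) : exists v, forall x, inner (w - a v) (a x) = 0.
Proof.
have [v vmin] := minimizer w; exists v => x.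
set z := w - a v; set c := inner z (a x).
have [ax0|ax0] := eqVneq (a x) 0; first by rewrite /c ax0 linear0r.
set n := inner (a x) (a x).
have n0 : 0 < n by rewrite /n innerE exprn_gt0 // normr_gt0.
pose t := c / n.
have nr : (n^*)%R = n by apply: CrealP; exact: gtr0_real.
have le : inner z z <= inner (z - t *: a x) (z - t *: a x).
  rewrite !innerE ler_pXn2r ?nnegrE //.
  have -> : z - t *: a x = w - a (v + t *: x).
    by rewrite (linearD a) (linearZ_LR a) /= opprD addrA.
  by rewrite !nrmE lecR; exact: vmin.
move: le; rewrite (dnormB _ z) dnormZ linearZr_LR /= -/c -/n normCK -subr_ge0.
have -> : inner z z + t * (t^*)%R * n - ((t^*)%R * c + ((t^*)%R * c)^*%R) - inner z z
   = - (`|c| ^+ 2 / n).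
  rewrite /t normCK !rmorphM /= !fmorphV /= conjCK !nr; field.
  by rewrite gt_eqF.
rewrite oppr_ge0 pmulr_lle0 ?invr_gt0 // => le0.
have : `|c| ^+ 2 = 0 by apply/eqP; rewrite eq_le le0 exprn_ge0.
by move/eqP; rewrite sqrf_eq0 normr_eq0 => /eqP.
Qed.

(* [coord w] is the unique vector of [V] whose image under [a] is the
   orthogonal projection of [w] onto the closed subspace [a(V)]. *)
Definition coord (w : W) : V := projT1 (cid (coord_exists w)).

Lemma coord_orth w x : inner (w - a (coord w)) (a x) = 0.
Proof. by rewrite /coord; case: cid. Qed.

Lemma coord_uniq w v : (forall x, inner (w - a v) (a x) = 0) -> coord w = v.
Proof.
move=> h; apply/eqP; rewrite -subr_eq0 -(dnorm_eq0 inner); apply/eqP.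
rewrite -isometry_inner.
set y := coord w - v.
have ay : a y = (w - a v) - (w - a (coord w)).
  by rewrite /y (linearB a) opprB [RHS]addrC addrA subrK.
by rewrite {1}ay linearBl /= h coord_orth subr0.
Qed.

Lemma coord_isometry v : coord (a v) = v.
Proof. by apply: coord_uniq => x; rewrite subrr linear0l. Qed.

Lemma coord_eq0 w : (forall v, inner w (a v) = 0) -> coord w = 0.
Proof. by move=> h; apply: coord_uniq => x; rewrite linear0 subr0. Qed.

Lemma coord_linear : linear coord.
Proof.
move=> c x y; apply: coord_uniq => z.
have -> : c *: x + y - a (c *: coord x + coord y) =
    c *: (x - a (coord x)) + (y - a (coord y)).
  by rewrite linearP scalerBr opprD addrACA.
by rewrite linearDl /= linearZl_LR /= !coord_orth mulr0 addr0.
Qed.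

(* Writing [w = a v + w'] with [w'] orthogonal to [a(V)], the unitary [u] of [V]
   is transported to [a v + w' |-> a (u v) + w']. *)
Definition extend_fun (u : unitary V) (w : W) : W :=
  a (u (coord w)) + (w - a (coord w)).

Lemma coord_extend u w : coord (extend_fun u w) = u (coord w).
Proof.
apply: coord_uniq => x; rewrite /extend_fun.
by rewrite [X in X - _]addrC addrK coord_orth.
Qed.

Fact extend_linear u : linear (extend_fun u).
Proof.
move=> c x y; rewrite /extend_fun coord_linear unitary_linear !(linearP a).
by rewrite scalerDr scalerBr opprD (addrACA (c *: x)) [LHS]addrACA.
Qed.

Lemma extend_funM (u v : unitary V) w :
  extend_fun (u * v)%g w = extend_fun u (extend_fun v w).
Proof.
rewrite {2}/extend_fun coord_extend /extend_fun /=.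
by rewrite [a (v _) + _]addrC addrK.
Qed.

Lemma extend_fun1 w : extend_fun 1%g w = w.
Proof. by rewrite /extend_fun /= addrC subrK. Qed.

Fact extend_bij u : bijective (extend_fun u).
Proof.
exists (extend_fun u^-1%g) => w; rewrite -extend_funM.
  by rewrite mulVg extend_fun1.
by rewrite mulgV extend_fun1.
Qed.

Let inner_split (v v' : V) (z z' : W) : (forall x, inner z (a x) = 0) ->
  (forall x, inner z' (a x) = 0) ->
  inner (a v + z) (a v' + z') = inner v v' + inner z z'.
Proof.
move=> hz hz'; rewrite linearDl /= !linearDr /= hz isometry_inner.
by rewrite (hermC inner (a v) z') /= hz' rmorph0 mulr0 addr0 add0r.
Qed.

Fact extend_inner u x y : inner (extend_fun u x) (extend_fun u y) = inner x y.
Proof.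
rewrite inner_split; do ?exact: coord_orth.
rewrite unitary_inner -inner_split; do ?exact: coord_orth.
by rewrite ![a _ + _]addrC !subrK.
Qed.

Definition extend (u : unitary V) : unitary W :=
  Unitary (extend_linear u) (extend_bij u) (extend_inner u).

Lemma extend_isometry u v : extend u (a v) = a (u v).
Proof. by rewrite /= /extend_fun coord_isometry subrr addr0. Qed.

Lemma extend_orth u w : (forall v, inner w (a v) = 0) -> extend u w = w.
Proof.
move=> /coord_eq0 w0; have u0 : u 0 = 0.
  by have := unitary_linear u (-1) 0 0; rewrite !scaleN1r oppr0 addr0 addNr.
by rewrite /= /extend_fun w0 u0 linear0 subr0 add0r.
Qed.

Fact extend_multiplicative : {morph extend : u v / (u * v)%g}.
Proof. by move=> u v; apply: unitary_ext => w; exact: extend_funM. Qed.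
HB.instance Definition _ :=
  isMultiplicative.Build _ _ extend extend_multiplicative.

End Projection.

Record Reps (R : realType) (G : groupType) (h : hilbertType R) := Rep {
  rep_space : hilbertType R;
  rep_hom :> {multiplicative G -> unitary rep_space};
  rep_embeds : inhabited (linear_isometry rep_space h)
}.

Section Pushforward.
Context {R : realType} {G : groupType} {h : hilbertType R}.
Variables (rho : Reps G h) (a : linear_isometry (rep_space rho) h).

Definition pushforward (g : G) : unitary h := extend a (rho g).

Fact pushforward_multiplicative : {morph pushforward : x y / (x * y)%g}.
Proof. by move=> x y; rewrite /pushforward !gmulfM. Qed.
HB.instance Definition _ :=
  isMultiplicative.Build _ _ pushforward pushforward_multiplicative.

End Pushforward.

Local Open Scope ereal_scope.

Record is_length (R : realType) (G : groupType) (l : G -> \bar R) : Prop :=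
  IsLength {
    length_ge0 : forall g, 0 <= l g;
    length_eq0 : forall g, l g = 0 <-> g = 1%g;
    length_inv : forall g, l g^-1%g = l g;
    length_mul : forall g k, l (g * k)%g <= l g + l k
  }.

Record is_biinvariant_metric (R : realType) (G : groupType)
    (d : G -> G -> \bar R) : Prop := IsBiinvariantMetric {
  metric_ge0 : forall x y, 0 <= d x y;
  metric_eq0 : forall x y, d x y = 0 <-> x = y;
  metric_sym : forall x y, d x y = d y x;
  metric_tri : forall x y z, d x z <= d x y + d y z;
  metric_mull : forall z x y, d (z * x)%g (z * y)%g = d x y;
  metric_mulr : forall z x y, d (x * z)%g (y * z)%g = d x y
}.

(* In [\bar R] the library has [+oo^-1 = 0] and [+oo * 0 = 0], so that
   [c / +oo = 0] for all [c]; this ratio differs by [+oo / +oo = 1]. *)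
Definition length_ratio (R : realType) (c l : \bar R) : \bar R :=
  if (c == +oo) && (l == +oo) then 1 else c / l.

(* [ereal_sup set0] is [-oo]; all the families considered here are nonnegative,
   so adjoining [0] only enforces the convention that the empty sup is [0]. *)
Definition sup0 (R : realType) (A : set (\bar R)) : \bar R :=
  ereal_sup (0 |` A).

Section DoubleDual.
Context {R : realType} {G : groupType} {h : hilbertType R}.
Variables (l : G -> \bar R) (d : unitary h -> unitary h -> \bar R).
Variable a : forall rho : Reps G h, linear_isometry (rep_space rho) h.

Definition unitary_length (u : unitary h) : \bar R := d 1%g u.

Definition rep_length (rho : Reps G h) (g : G) : \bar R :=
  unitary_length (pushforward (a rho) g).

Definition Reps_length (rho : Reps G h) : \bar R :=
  sup0 [set length_ratio (rep_length rho g) (l g) | g in [set g | l g != 0]].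

Definition double_dual (g : G) : \bar R :=
  sup0 [set c | exists2 rho : Reps G h,
    Reps_length rho != 0 & c = rep_length rho g / Reps_length rho].

End DoubleDual.

(* Main.v *)
Require Import Defs.
From mathcomp Require Import all_boot all_order all_algebra.
From mathcomp Require Import all_classical all_reals all_analysis.

Set Implicit Arguments.
Unset Strict Implicit.
Unset Printing Implicit Defensive.

Import Order.TTheory.

Local Open Scope ereal_scope.

(** Duality exchanges two denominators: [Reps_length] is a supremum of quotients c / [l g], so c /
    [l g] <= L, hence c <= L * [l g] and c / L <= [l g]. This is [rep_length_div_le]; taking the
    supremum over representations gives (1). A representation attaining the bound at [g] forces
    equality there ([double_dual_eq]), which is (3). An isometric representation has [Reps_length] 1
    once [l] is nonzero somewhere, so it attains the bound wherever [l] is nonzero; where [l]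
    vanishes, (1) and nonnegativity suffice, giving (2). *)

Lemma ge_sup0 (R : realType) (A : set (\bar R)) (x : \bar R) :
  0 <= x -> (forall y, A y -> y <= x) -> Defs.sup0 A <= x.
Proof. by move=> x0 Ax; apply: ge_ereal_sup => y [->//|/Ax]. Qed.

Lemma sup0_ge0 (R : realType) (A : set (\bar R)) : 0 <= Defs.sup0 A.
Proof. by apply: ereal_sup_ubound; left. Qed.

Lemma sup0_ubound (R : realType) (A : set (\bar R)) (x : \bar R) :
  A x -> x <= Defs.sup0 A.
Proof. by move=> Ax; apply: ereal_sup_ubound; right. Qed.

(** For [x = +oo] this is exactly the convention [+oo / +oo = 1]; it lets isometric representations
    be handled even when [l] takes infinite values. *)
Lemma length_ratio_id (R : realType) (x : \bar R) :
  0 <= x -> x != 0 -> length_ratio x x = 1.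
Proof.
rewrite /length_ratio; case: x => [r| |] //= r0 rn0.
by rewrite divee.
Qed.

Section DoubleDualBounds.
Context {R : realType} {G : groupType} {l : G -> \bar R} (hl : is_length l).
Context {h : hilbertType R} {d : unitary h -> unitary h -> \bar R}.
Context (hd : is_biinvariant_metric d).
Context (a : forall rho : Reps G h, linear_isometry (rep_space rho) h).

(** Settles the only point where [l] vanishes, which the supremum in [Reps_length] leaves out. *)
Lemma rep_length1 (rho : Reps G h) : rep_length d a rho 1%g = 0.
Proof.
have u1 : Defs.pushforward (a rho) 1%g = 1%g.
  apply: (mulgI (Defs.pushforward (a rho) 1%g)).
  by rewrite -pushforward_multiplicative !mulg1.
rewrite /rep_length /unitary_length u1.
exact/(metric_eq0 hd).
Qed.

Lemma rep_length_div_le (rho : Reps G h) (g : G) :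
  Reps_length l d a rho != 0 ->
  rep_length d a rho g / Reps_length l d a rho <= l g.
Proof.
have [lg0 L0|lg0] := eqVneq (l g) 0.
  have -> : g = 1%g by exact/(length_eq0 hl).
  by rewrite rep_length1 mul0e (length_ge0 hl).
have : length_ratio (rep_length d a rho g) (l g) <= Reps_length l d a rho.
  by apply: sup0_ubound; exists g.
have : 0 <= Reps_length l d a rho by exact: sup0_ge0.
have := length_ge0 hl g.
(* If [Reps_length] is [+oo], the quotient is 0 because [+oo^-1 = 0]. *)
case: (Reps_length l d a rho) => [L| |] // lg_ge0 L_ge0; last first.
  by rewrite invey mule0.
case: (l g) lg0 lg_ge0 => [r| |] // r0 r_ge0; last by rewrite leey.
have r_gt0 : (0 < r)%R by rewrite -lte_fin lt0e r0.
(* With [l g] finite the [+oo / +oo] clause is off, and both denominators are positive reals. *)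
rewrite /length_ratio andbF inver (gt_eqF r_gt0) lee_pdivrMr // => cL L0.
have L_gt0 : (0 < L)%R by rewrite -lte_fin lt0e L0.
by rewrite inver (gt_eqF L_gt0) lee_pdivrMr // muleC.
Qed.

Lemma double_dual_le (g : G) : double_dual l d a g <= l g.
Proof.
apply: ge_sup0 => [|_ [rho L0 ->]]; first exact: (length_ge0 hl).
exact: rep_length_div_le.
Qed.

Lemma double_dual_eq (g : G) :
  (exists2 rho : Reps G h, Reps_length l d a rho != 0 &
    l g = rep_length d a rho g / Reps_length l d a rho) ->
  double_dual l d a g = l g.
Proof.
move=> lg; apply/eqP; rewrite eq_le double_dual_le /=.
exact: sup0_ubound.
Qed.

(** Every quotient in the supremum equals 1; the point [g] makes the family nonempty, as otherwise
    the supremum would be 0. *)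
Lemma Reps_length_isometric (rho : Reps G h) (g : G) :
  (forall k : G, rep_length d a rho k = l k) -> l g != 0 ->
  Reps_length l d a rho = 1.
Proof.
move=> iso lg0; apply/eqP; rewrite eq_le; apply/andP; split.
  apply: ge_sup0 => // _ [k /= lk0 <-].
  by rewrite iso length_ratio_id // (length_ge0 hl).
apply: sup0_ubound; exists g => //.
by rewrite iso length_ratio_id // (length_ge0 hl).
Qed.

Lemma double_dual_isometric (rho : Reps G h) :
  (forall k : G, rep_length d a rho k = l k) ->
  forall g : G, double_dual l d a g = l g.
Proof.
move=> iso g; have [lg0|lg0] := eqVneq (l g) 0.
  (* [rho] cannot serve as witness here: [Reps_length rho = 0] if [G] is trivial. *)
  apply/eqP; rewrite eq_le double_dual_le lg0 /=.
  exact: sup0_ge0.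
apply: double_dual_eq; exists rho;
  rewrite (Reps_length_isometric iso lg0) ?onee_neq0 //.
by rewrite inve1 mule1 iso.
Qed.

End DoubleDualBounds.

Theorem proposition3p5 (R : realType) (G : groupType) (l : G -> \bar R)
    (hl : is_length l)
    (h : hilbertType R) (hdim : infinite_dimensional h)
    (d : unitary h -> unitary h -> \bar R) (hd : is_biinvariant_metric d)
    (a : forall rho : Reps G h, linear_isometry (rep_space rho) h) :
  [/\ forall g : G, double_dual l d a g <= l g,
      (exists rho : Reps G h, forall g : G, rep_length d a rho g = l g) ->
        double_dual l d a = l
    & (forall g : G, exists2 rho : Reps G h,
          Reps_length l d a rho != 0 &
          l g = rep_length d a rho g / Reps_length l d a rho) ->
        double_dual l d a = l].
Proof.
split=> [g|[rho iso]|attained].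
- exact: double_dual_le.
- exact/funext/(double_dual_isometric hl hd iso).
- by apply/funext => g; exact: double_dual_eq.
Qed.
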